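(* Consider $N$ agents $\vartheta_k\in\mathbb{S}^1$, $k=1,\dots,N$, communicating via a strongly connected directed graph $\mathcal{G}=(\mathcal{V},\mathcal{E})$ with vertex set $\mathcal{V}=\{1,\dots,N\}$, according to $$\dot\vartheta_k=\omega_k+\sum_{i:(k,i)\in\mathcal{E}}f_{ki}(\vartheta_i-\vartheta_k),\qquad k=1,\dots,N,$$ where $\omega_k\in\mathbb{R}$ are constants and each $f_{ki}:\mathbb{R}\to\mathbb{R}$ is an odd, $2\pi$-periodic coupling function that is continuously differentiable on $(-\pi,\pi)$ and satisfies $f_{ki}(0)=0$ and $f_{ki}'(\alpha)>0$ for all $\alpha\in(-\pi,\pi)$. Let $S\subseteq\mathbb{T}^N$ be a bounded, connected, and forward invariant region such that $$S\subset\{\vartheta\in\mathbb{T}^N:|\vartheta_k-\vartheta_i|\neq\pi\ \ \forall (k,i)\in\mathcal{E}\}.$$ Then every trajectory starting in $S$ asymptotically converges to a unique integral curve of the vector field $$\boldsymbol{1}_\vartheta=\sum_{i=1}^N\frac{\partial}{\partial\vartheta^i}\Big|_\vartheta$$ on $\mathbb{T}^N$.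
   Context: $\mathbb{T}^N=\mathbb{S}^1\times\cdots\times\mathbb{S}^1$ is the $N$-torus with angular coordinates $\vartheta=(\vartheta_1,\dots,\vartheta_N)$ and the standard coordinate vector fields $\partial/\partial\vartheta^i$; differences $\vartheta_i-\vartheta_k$ are taken modulo $2\pi$ (well defined as arguments of the $2\pi$-periodic $f_{ki}$), and $|\vartheta_k-\vartheta_i|\ne\pi$ means the two angles are not antipodal. A directed graph is strongly connected if there is a directed path from every vertex to every other vertex. An integral curve of $\boldsymbol{1}_\vartheta$ is a curve $\gamma$ with $\gamma'(s)=\boldsymbol{1}_{\gamma(s)}$, i.e. of the form $s\mapsto(\vartheta_1+s,\dots,\vartheta_N+s)$. *)

(* Defs.v *)
From HB Require Import structures.
From mathcomp Require Import all_boot all_order all_algebra.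
From mathcomp Require Import all_classical all_reals all_analysis.
Set Implicit Arguments. Unset Strict Implicit. Unset Printing Implicit Defensive.
Import Order.TTheory GRing.Theory Num.Theory.
Import numFieldTopology.Exports numFieldNormedType.Exports.
Local Open Scope classical_set_scope.
Local Open Scope ring_scope.

(* Embedding of the N-torus T^N = (S^1)^N into (R x R)^N:
   the lift x : 'I_N -> R (angles) is sent to (cos x_k, sin x_k)_k. *)
Definition plane (R : realType) : topologicalType := (R * R)%type.
Definition torus_amb (R : realType) (N : nat) : topologicalType :=
  {ptws 'I_N -> plane R}.
Definition torus_proj (R : realType) (N : nat) (x : 'I_N -> R) : torus_amb R N :=
  fun k => ((cos (x k), sin (x k)) : plane R).

Definition strongly_connected (N : nat) (E : rel 'I_N) : Prop :=
  forall u v : 'I_N, connect E u v.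

Definition coupling_fun (R : realType) (f : R -> R) : Prop :=
  (forall x, f (- x) = - f x) /\
  (forall x, f (x + 2 * pi) = f x) /\
  (forall x, - pi < x < pi -> derivable f x 1) /\
  (forall x, - pi < x < pi -> {for x, continuous (derive1 f)}) /\
  f 0 = 0 /\
  (forall x, - pi < x < pi -> 0 < derive1 f x).

Definition kuramoto_rhs (R : realType) (N : nat) (E : rel 'I_N)
  (omega : 'I_N -> R) (f : 'I_N -> 'I_N -> R -> R) (x : 'I_N -> R) (k : 'I_N) : R :=
  omega k + \sum_(i < N | E k i) f k i (x i - x k).

(* th : R -> R^N (a lift to R^N of a curve in T^N) is a forward solution:
   continuous on [0,+oo), differentiable on (0,+oo) satisfying the ODE. *)
Definition is_solution (R : realType) (N : nat) (E : rel 'I_N)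
  (omega : 'I_N -> R) (f : 'I_N -> 'I_N -> R -> R) (th : R -> 'I_N -> R) : Prop :=
  (forall k, {within `[0, +oo[%classic, continuous (fun t => th t k)}) /\
  (forall t, 0 < t -> forall k,
     derivable (fun s => th s k) t 1 /\
     derive1 (fun s => th s k) t = kuramoto_rhs E omega f (th t) k).

Definition forward_invariant (R : realType) (N : nat) (E : rel 'I_N)
  (omega : 'I_N -> R) (f : 'I_N -> 'I_N -> R -> R) (S : set (torus_amb R N)) : Prop :=
  forall th, is_solution E omega f th -> S (torus_proj (th 0)) ->
    forall t, 0 <= t -> S (torus_proj (th t)).

(* dist_{T^N}(th(t), Gamma_phi) -> 0 as t -> +oo, where
   Gamma_phi = { phi + s 1 : s in R } (mod 2pi) is the integral curve of the
   vector field 1 through phi (sup-metric on the angles, mod 2pi). *)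
Definition converges_to_curve (R : realType) (N : nat)
  (th : R -> 'I_N -> R) (phi : 'I_N -> R) : Prop :=
  forall e : R, 0 < e -> exists T : R, forall t, T <= t ->
    exists s : R, forall k, exists m : int,
      `| th t k - (phi k + s) - 2 * pi * m%:~R | < e.

Definition same_curve (R : realType) (N : nat) (phi psi : 'I_N -> R) : Prop :=
  exists s : R, forall k, exists m : int, psi k = phi k + s + 2 * pi * m%:~R.

(* Main.v *)
Require Import Defs.
From HB Require Import structures.
From mathcomp Require Import all_boot all_order all_algebra.
From mathcomp Require Import all_classical all_reals all_analysis.
From mathcomp Require Import lra.
Set Implicit Arguments. Unset Strict Implicit. Unset Printing Implicit Defensive.
Import Order.TTheory GRing.Theory Num.Theory.
Import numFieldTopology.Exports numFieldNormedType.Exports.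
Local Open Scope classical_set_scope.
Local Open Scope ring_scope.

(** Along a lifted trajectory every edge difference stays in one open window of length
[2 pi] on which its coupling is increasing, but it may approach the ends of the window,
where the coupling may even blow up.  Monotonicity makes the maximum over the nodes
of [x (s + t) - x (s' + t)] nonincreasing in [t].  Hence the trajectory has a mean speed;
after subtracting it the trajectory [x] is bounded, limits of its time translates are
uniform, and [x] is asymptotically almost periodic, so two limit curves [y], [z] keep
[max (y - z)] constant.

Let [b], [a] be the coordinatewise limsup and liminf of [x], and choose [y], [z] realising
[M = max (b - a)] at some node.  At every time some nodes satisfy [y - z = M], hence
[y = b] and [z = a]; at a time where these nodes [A] are fewest, [A] is locally constant.
A node of [A] either has a neighbour in [A] at the upper end of its window, or has all its
neighbours in [A] and balanced finite forces.  Comparing [y] with the constant [b] on the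
nodes of the second kind shows that [y] stays at [b] there forever; so the liminf of [x]
equals its limsup at such a node, [M <= 0], and [x] converges. *)

(** * Maxima of finitely many functions, limsup, monotone limits, quasi-additivity *)

Lemma near0_forall (R : realType) (I : finType) (Q : I -> R -> Prop) :
  (forall k, exists2 h : R, 0 < h & forall s, 0 < s <= h -> Q k s) ->
  exists2 h : R, 0 < h & forall k s, 0 < s <= h -> Q k s.
Proof.
move=> H; have {}H k : exists e : R, 0 < e /\ forall s, 0 < s <= e -> Q k s.
  by case: (H k) => e e0 eP; exists e.
have [h hP] := choice H.
exists (\big[Order.min/1]_k h k).
  by apply: (lt_bigmin (index_enum I) ltr01) => k _; case: (hP k).
move=> k s /andP[s0 sh]; apply: (hP k).2; rewrite s0 /=.
exact: le_trans sh (bigmin_le _ _ _).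
Qed.

(** Only the functions attaining the maximum need a growth bound, namely a nonpositive upper right
    Dini derivative; the others stay below for a while by continuity. Allowing slope [e] gives the
    strict room needed to continue the bound past any time. *)
Lemma max_nonincreasing (R : realType) (I : finType) (P : pred I)
    (g : I -> R -> R) (M : R) :
  (forall k, P k -> forall t, 0 <= t -> forall e, 0 < e -> exists2 d, 0 < d &
     forall s, 0 <= s -> `|s - t| <= d -> `|g k s - g k t| <= e) ->
  (forall k t, P k -> 0 <= t -> (forall i, P i -> g i t <= g k t) ->
     forall e, 0 < e -> exists2 h, 0 < h &
       forall s, 0 < s <= h -> g k (t + s) <= g k t + e * s) ->
  (forall k, P k -> g k 0 <= M) ->
  forall t, 0 <= t -> forall k, P k -> g k t <= M.
Proof.
move=> gc gd g0 t t0 k Pk.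
suff H e : 0 < e -> forall t, 0 <= t -> forall k, P k -> g k t <= M + e * t.
  apply/ler_addgt0Pr => e e0.
  have e1 : 0 < e / (t + 1) by apply: divr_gt0 => //; lra.
  (* The slope [e / (t + 1)] keeps the total excess at time [t] below [e]. *)
  have := H _ e1 t t0 k Pk; suff : e / (t + 1) * t <= e by lra.
  rewrite -mulrA ler_piMr ?(ltW e0)// mulrC ler_pdivrMr; lra.
move=> e0 {t t0 k Pk} t1 t10 k1 Pk1; apply: contrapT => /negP; rewrite -ltNge => Hk1.
(* The times up to which the relaxed bound holds; it also holds at their supremum [tau], and then
   beyond, so [tau = t1]. *)
pose A := [set t | 0 <= t <= t1 /\ forall s, 0 <= s <= t -> forall k, P k -> g k s <= M + e * s].
have A0 : A 0.
  split; first by rewrite lexx.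
  move=> s /andP[s0 s1] k Pk; have -> : s = 0 by apply/eqP; rewrite eq_le s0 s1.
  by rewrite mulr0 addr0; exact: g0.
have hA : has_sup A.
  by split; [exists 0 | exists t1 => t [/andP[]]].
pose tau := sup A.
have tau0 : 0 <= tau by apply: sup_upper_bound.
have tau1 : tau <= t1 by apply: ge_sup; [exists 0 | move=> t [/andP[]]].
have belowtau s : 0 <= s < tau -> forall k, P k -> g k s <= M + e * s.
  move=> /andP[s0 st] k Pk.
  have [u [/andP[u0 u1] Hu] su] := sup_adherent (eps := tau - s) ltac:(lra) hA.
  by apply: Hu => //; rewrite s0 /= ltW// (le_lt_trans _ su)// /tau; lra.
have attau k : P k -> g k tau <= M + e * tau.
  move=> Pk; have [tau_eq0|tau_gt0] : tau = 0 \/ 0 < tau.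
    by move: tau0; rewrite le_eqVlt => /orP[/eqP|]; [left|right].
    by rewrite tau_eq0 mulr0 addr0; exact: g0.
  apply/ler_addgt0Pr => e' e'0.
  have [d d0 dP] := gc k Pk tau tau0 e' e'0.
  have [s [s0 st sd]] : exists s, [/\ 0 <= s, s < tau & `|s - tau| <= d].
    exists (Num.max 0 (tau - d)); rewrite le_max lexx /= gt_max tau_gt0 /=.
    split => //; first lra.
    by rewrite ler_norml; have [h|h] := leP 0 (tau - d); apply/andP; split; lra.
  have := dP s s0 sd; rewrite ler_norml => /andP[h1 h2].
  have := belowtau s ltac:(by rewrite s0) k Pk.
  have : e * s <= e * tau by rewrite ler_pM2l// ltW.
  lra.
have [h h0 hP] : exists2 h : R, 0 < h & forall k s, 0 < s <= h ->
    P k -> g k (tau + s) <= M + e * (tau + s).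
  apply: near0_forall => k; have [Pk|nPk] := boolP (P k); last by exists 1 => //.
  have := attau k Pk; rewrite le_eqVlt => /orP[/eqP eqk|ltk].
    have [h h0 hP] := gd k tau Pk tau0 ltac:(move=> i Pi; rewrite eqk; exact: attau) e e0.
    by exists h => // s /hP; rewrite eqk mulrDr; lra.
  have [d d0 dP] := gc k Pk tau tau0 (M + e * tau - g k tau) ltac:(lra).
  exists d => // s /andP[s0 sd] _.
  have := dP (tau + s) ltac:(lra); rewrite addrC addKr => /(_ ltac:(by rewrite gtr0_norm)).
  rewrite ler_norml => /andP[_]; rewrite mulrDr.
  have : 0 < e * s by apply: mulr_gt0.
  lra.
have [/eqP tauE|taut1] := boolP (tau == t1).
  by have := attau k1 Pk1; rewrite tauE; lra.
have {}tau1 : tau < t1 by rewrite lt_neqAle taut1.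
pose s1 := Num.min h (t1 - tau).
have s10 : 0 < s1 by rewrite lt_min h0 /=; lra.
have : A (tau + s1).
  split; first by apply/andP; split; [lra|have : s1 <= t1 - tau by rewrite ge_min lexx orbT]; lra.
  move=> s /andP[s0 ss] k Pk; have [sl|sl|->] := ltgtP s tau.
  - by apply: belowtau => //; rewrite s0.
  - have -> : s = tau + (s - tau) by lra.
    apply: hP => //; have : s1 <= h by rewrite ge_min lexx.
    by move=> ?; apply/andP; split; lra.
  - exact: attau.
by move/(sup_upper_bound hA); rewrite -/tau; lra.
Qed.

Lemma is_derive_dist (R : realType) (g : R -> R) (t d : R) :
  is_derive t 1 g d -> forall e, 0 < e -> exists2 h, 0 < h &
    forall s, `|s| <= h -> `|g (t + s) - g t - d * s| <= e * `|s|.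
Proof.
move=> [gd <-] e e0.
have /cvgr_dist_lt/(_ _ e0) := gd.
rewrite near_withinE near_simpl -nbhs_nearE => /nbhs_ballP[h /= h0 hP].
exists (h / 2); first lra.
move=> s sh; have [->|s0] := eqVneq s 0.
  by rewrite addr0 mulr0 subrr subr0 normr0 mulr0.
have /(_ ltac:(rewrite /ball /= sub0r normrN; lra) s0) := hP s.
rewrite /= -[lim _]/('D_1 g t) /GRing.scale /= mulr1 (addrC s t) => H.
have -> : g (t + s) - g t - 'D_1 g t * s =
    - (('D_1 g t - s^-1 * (g (t + s) - g t)) * s).
  by rewrite mulrBl mulrAC mulVf// mul1r opprB.
by rewrite normrN normrM ler_wpM2r// ltW.
Qed.

(** Here [b] is the limsup of [g] at infinity, obtained as the infimum of the eventual upper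
    bounds. *)
Lemma limsup_exists (R : realType) (g : R -> R) (B : R) :
  (forall t, 0 <= t -> `|g t| <= B) ->
  exists b, (forall e, 0 < e -> exists2 T, 0 <= T & forall t, T <= t -> g t <= b + e) /\
    (forall e T, 0 < e -> exists2 t, T <= t & `|g t - b| <= e).
Proof.
move=> gB.
pose A := [set v | exists2 T, 0 <= T & forall t, T <= t -> g t <= v].
have hA : has_inf A.
  split.
    by exists B, 0 => // t t0; have := gB t t0; rewrite ler_norml => /andP[].
  exists (- B) => v [T T0 /(_ T (lexx _))].
  by have := gB T T0; rewrite ler_norml => /andP[h _]; apply: le_trans.
have up e : 0 < e -> exists2 T, 0 <= T & forall t, T <= t -> g t <= inf A + e.
  move=> e0; have [v [T T0 TP] vA] := inf_adherent e0 hA.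
  by exists T => // t /TP h; lra.
exists (inf A); split => // e T e0.
have [T1 T10 T1P] := up e e0.
have [t [Tt T1t gt]] : exists t, [/\ T <= t, T1 <= t & inf A - e <= g t].
  apply: contrapT => /forallNP H.
  have : A (inf A - e).
    exists (Num.max T T1); first by rewrite le_max T10 orbT.
    move=> t; rewrite ge_max => /andP[h1 h2].
    rewrite leNgt; apply/negP => h3; apply: (H t); split => //; exact: ltW.
  by move=> /(inf_lbound hA.2); lra.
by exists t => //; rewrite ler_norml; have := T1P t T1t; lra.
Qed.

(* [b] may be the left end [l], where [phi] is then the limit of [f] from the right. *)
Lemma monotone_value (R : realType) (l r b : R) (f : R -> R) :
  (forall u v, l < u < r -> l < v < r -> u <= v -> f u <= f v) ->
  (forall u, l < u < r -> {for u, continuous f}) ->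
  l <= b < r -> (b = l -> exists K, forall u, l < u < r -> K <= f u) ->
  exists phi, forall e, 0 < e -> exists2 d, 0 < d & forall u, l < u < r ->
    (b - d <= u -> phi - e <= f u) /\ (u <= b + d -> f u <= phi + e).
Proof.
move=> fm fc /andP[]; rewrite le_eqVlt => /orP[/eqP <- lr /(_ erefl)[K KP]|lb br _].
  pose A := [set f u | u in [set u | l < u < r]].
  have hA : has_inf A.
    split; first by exists (f ((l + r) / 2)), ((l + r) / 2) => //=; apply/andP; split; lra.
    by exists K => _ [u /= lur <-]; exact: KP.
  exists (inf A) => e e0; have [_ [u /= /andP[lu ur] <-] uA] := inf_adherent e0 hA.
  exists (u - l); first lra.
  move=> v /andP[lv vr]; split=> [_|vu].
    have : A (f v) by exists v => //=; rewrite lv.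
    by move=> /(inf_lbound hA.2); lra.
  have := fm v u ltac:(by rewrite lv) ltac:(by rewrite lu) ltac:(lra); lra.
exists (f b) => e e0.
have /fc/cvgr_dist_lt/(_ _ e0) : l < b < r by rewrite lb.
rewrite -nbhs_nearE => /nbhs_ballP[d /= d0 dP].
(* Both [b - d'] and [b + d'] lie in the window, and by monotonicity the values there control [f] on
   each side. *)
pose d' := Num.min (d / 2) (Num.min ((b - l) / 2) ((r - b) / 2)).
have [d'0 d'd d'l d'r] : [/\ 0 < d', d' <= d / 2, d' <= (b - l) / 2 & d' <= (r - b) / 2].
  by rewrite /d' !lt_min !ge_min !lexx ?orbT /=; split => //; lra.
have bl : l < b - d' < r by apply/andP; split; lra.
have bu : l < b + d' < r by apply/andP; split; lra.
exists d' => // u lur; split=> h.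
  have := fm _ _ bl lur h.
  have := dP (b - d') ltac:(rewrite /ball /= opprD addrA subrr add0r opprK gtr0_norm//; lra).
  by rewrite ltr_norml; lra.
have := fm _ _ lur bu h.
have := dP (b + d') ltac:(rewrite /ball /= opprD addrA subrr add0r normrN gtr0_norm//; lra).
by rewrite ltr_norml; lra.
Qed.

(** Computing [q] at [n * m] in two ways shows that the intervals of centre [q n / n] and radius
    [K / n] meet pairwise; the supremum of their left ends lies in all of them and is the slope. *)
Lemma quasi_additive_linear (R : realType) (q : R -> R) (K B : R) :
  (forall s t, 0 <= s -> 0 <= t -> `|q (s + t) - q s - q t| <= K) ->
  (forall t, 0 <= t <= 1 -> `|q t| <= B) ->
  exists c D, forall t, 0 <= t -> `|q t - c * t| <= D.
Proof.
move=> qK qB.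
have mulq n m : `|q (n.+1 * m)%:R - n.+1%:R * q m%:R| <= n%:R * K.
  elim: n => [|n IH]; first by rewrite mul1n mul1r subrr normr0 mul0r.
  have := qK (n.+1 * m)%:R m%:R (ler0n _ _) (ler0n _ _).
  rewrite -natrD -mulSnr; move: IH; rewrite !ler_norml.
  have -> : n.+2%:R = n.+1%:R + 1 :> R by rewrite natr1.
  have -> : n.+1%:R * K = n%:R * K + K by rewrite -natr1 mulrDl mul1r.
  by rewrite mulrDl mul1r; lra.
pose A := [set (q n.+1%:R - K) / n.+1%:R | n in [set: nat]].
have K0 : 0 <= K by apply: le_trans (qK 0 0 _ _).
have Aub m : ubound A ((q m.+1%:R + K) / m.+1%:R).
  move=> _ [n _ <-].
  rewrite ler_pdivrMr ?ltr0n// mulrAC ler_pdivlMr ?ltr0n//.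
  have := mulq n m.+1; have := mulq m n.+1; rewrite (mulnC m.+1) !ler_norml.
  rewrite -![_.+1%:R]natr1; lra.
have hA : has_sup A.
  by split; [exists ((q 1%:R - K) / 1%:R), 0%N | exists ((q 1%:R + K) / 1%:R); exact: Aub].
(* One [K] comes from the integer part of [t], one from splitting off the fractional part, where [q]
   is at most [B] and the linear term at most the slope. *)
exists (sup A), (K + K + B + `|sup A|) => t t0.
set c := sup A.
have cn n : `|q n%:R - c * n%:R| <= K.
  case: n => [|n].
    rewrite mulr0 subr0; have := qK 0 0 (lexx _) (lexx _).
    by rewrite addr0 subrr sub0r normrN.
  have n0 : 0 < n.+1%:R :> R by rewrite ltr0n.
  have h1 : c <= (q n.+1%:R + K) / n.+1%:R by apply: ge_sup => //; exact: hA.1.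
  have h2 : (q n.+1%:R - K) / n.+1%:R <= c by apply: sup_upper_bound => //; exists n.
  move: h1 h2; rewrite ler_pdivlMr// ler_pdivrMr// ler_norml; lra.
have /andP[h1 h2] := truncn_itv t0; set n := Num.trunc t in h1 h2.
have := qK n%:R (t - n%:R) (ler0n _ _) ltac:(lra).
have := qB (t - n%:R) ltac:(move: h2; rewrite -natr1 => h2; apply/andP; split; lra).
have := cn n; have -> : n%:R + (t - n%:R) = t by lra.
have : `|c * (t - n%:R)| <= `|c|.
  rewrite normrM ler_piMr// ger0_norm; last lra.
  by move: h2; rewrite -natr1; lra.
by rewrite mulrBr !ler_norml; lra.
Qed.

(** * Solutions confined to windows, their mean speed and their limit curves *)

(** Nothing is assumed of the couplings outside the open windows, nor of their behaviour at the
    ends. The derivative is two-sided even at time 0, so a trajectory must be restarted at a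
    positive time to fit. *)
Record window_solution (R : realType) (N : nat) (E : rel 'I_N)
    (l r : 'I_N -> 'I_N -> R) (f : 'I_N -> 'I_N -> R -> R) (om : 'I_N -> R)
    (x : R -> 'I_N -> R) : Prop := WindowSolution {
  coupling_incr : forall k i, E k i -> forall u v,
    l k i < u < r k i -> l k i < v < r k i -> u < v -> f k i u < f k i v;
  coupling_cont : forall k i, E k i -> forall u,
    l k i < u < r k i -> {for u, continuous (f k i)};
  in_window : forall t : R, 0 <= t -> forall k i, E k i ->
    l k i < x t i - x t k < r k i;
  solves : forall t : R, 0 <= t -> forall k,
    is_derive t 1 (fun s => x s k) (kuramoto_rhs E om f (x t) k) }.

(** An omega-limit point taken as a whole curve, approached uniformly by late translates. It need
    not solve the equation, since its edge differences may lie at window ends. *)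
Definition limit_curve (R : realType) (N : nat) (x y : R -> 'I_N -> R) : Prop :=
  forall e T, 0 < e -> exists2 s, Num.max 0 T <= s &
    forall t, 0 <= t -> forall k, `|y t k - x (s + t) k| <= e.

Section WindowSolution.
Variables (R : realType) (N : nat) (E : rel 'I_N).
Variables (l r : 'I_N -> 'I_N -> R) (f : 'I_N -> 'I_N -> R -> R).
Variables (om : 'I_N -> R) (x : R -> 'I_N -> R).
Hypothesis xsol : window_solution E l r f om x.

Lemma coupling_homo k i : E k i -> forall u v,
  l k i < u < r k i -> l k i < v < r k i -> u <= v -> f k i u <= f k i v.
Proof.
move=> Eki u v hu hv; rewrite le_eqVlt => /orP[/eqP->//|uv].
exact/ltW/(coupling_incr xsol).
Qed.

Lemma solution_continuous k t : 0 <= t -> forall e, 0 < e -> exists2 d, 0 < d &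
  forall s, `|s - t| <= d -> `|x s k - x t k| <= e.
Proof.
move=> t0 e e0; have [h h0 hP] := is_derive_dist (solves xsol t0 k) ltr01.
set v := kuramoto_rhs _ _ _ _ _ in hP.
have v0 : 0 < `|v| + 1 by have := normr_ge0 v; lra.
exists (Num.min h (e / (`|v| + 1))); first by rewrite lt_min h0 divr_gt0.
move=> s; rewrite le_min ler_pdivlMr// => /andP[sh se].
have := hP (s - t) sh; have -> : t + (s - t) = s by lra.
rewrite mul1r => H.
have -> : x s k - x t k = (x s k - x t k - v * (s - t)) + v * (s - t) by rewrite subrK.
apply: le_trans (ler_normD _ _) _; rewrite normrM.
by move: se; rewrite mulrDr mulr1 mulrC; lra.
Qed.

(* At a node maximising [x (s + t) k - x (s' + t) k] all differences to its neighbours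
   are at most those at time [s' + t], so monotonicity makes the derivative nonpositive. *)
Lemma solution_nonexpansive s s' M : 0 <= s -> 0 <= s' ->
  (forall k, x s k - x s' k <= M) ->
  forall t, 0 <= t -> forall k, x (s + t) k - x (s' + t) k <= M.
Proof.
move=> s0 s'0 H t t0 k.
apply: (@max_nonincreasing R 'I_N xpredT (fun k t => x (s + t) k - x (s' + t) k) M) => //.
- move=> {}k _ {}t {}t0 e e0.
  have [d d0 dP] := @solution_continuous k (s + t) ltac:(lra) (e / 2) ltac:(lra).
  have [d' d'0 d'P] := @solution_continuous k (s' + t) ltac:(lra) (e / 2) ltac:(lra).
  exists (Num.min d d'); first by rewrite lt_min d0.
  move=> u u0; rewrite le_min => /andP[ud ud'].
  have := dP (s + u) ltac:(by rewrite opprD addrACA subrr add0r).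
  have := d'P (s' + u) ltac:(by rewrite opprD addrACA subrr add0r).
  by rewrite !ler_norml; lra.
- move=> {}k {}t _ {}t0 kmax e e0.
  have st0 : 0 <= s + t by lra.
  have st'0 : 0 <= s' + t by lra.
  have [h h0 hP] := is_derive_dist (solves xsol st0 k) (e := e / 2) ltac:(lra).
  have [h' h'0 h'P] := is_derive_dist (solves xsol st'0 k) (e := e / 2) ltac:(lra).
  have vle : kuramoto_rhs E om f (x (s + t)) k <= kuramoto_rhs E om f (x (s' + t)) k.
    rewrite lerD2l; apply: ler_sum => i Eki; apply: coupling_homo => //.
    + exact: (in_window xsol).
    + exact: (in_window xsol).
    + by have := kmax i isT; lra.
  exists (Num.min h h'); first by rewrite lt_min h0.
  move=> u; rewrite le_min => /andP[u0 /andP[uh uh']].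
  have := hP u ltac:(by rewrite gtr0_norm); have := h'P u ltac:(by rewrite gtr0_norm).
  rewrite (gtr0_norm u0) !ler_norml !addrA => /andP[h1 _] /andP[_ h2].
  have : kuramoto_rhs E om f (x (s + t)) k * u <= kuramoto_rhs E om f (x (s' + t)) k * u.
    by rewrite ler_pM2r.
  by lra.
- by move=> {}k _; rewrite !addr0.
Qed.

Lemma solution_nonexpansive_norm s s' M : 0 <= s -> 0 <= s' ->
  (forall k, `|x s k - x s' k| <= M) ->
  forall t, 0 <= t -> forall k, `|x (s + t) k - x (s' + t) k| <= M.
Proof.
move=> s0 s'0 H t t0 k.
have h1 := @solution_nonexpansive s s' M s0 s'0
  (fun k => le_trans (ler_norm _) (H k)) t t0 k.
have h2 := @solution_nonexpansive s' s M s'0 s0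
  ltac:(move=> k'; apply: le_trans (ler_norm _) _; by rewrite distrC) t t0 k.
by rewrite ler_norml; lra.
Qed.

(** Every edge difference is confined to its window, and a directed path joins any two nodes. *)
Lemma differences_bounded : strongly_connected E ->
  exists C, forall t, 0 <= t -> forall i k, `|x t i - x t k| <= C.
Proof.
move=> Econn.
have H (p : 'I_N * 'I_N) : exists C, forall t, 0 <= t -> `|x t p.1 - x t p.2| <= C.
  case: p => v u /=; have /connectP[p] := Econn u v.
  elim: p u => [|w p IH] u /=.
    by move=> _ ->; exists 0 => t _; rewrite subrr normr0.
  move=> /andP[Euw wp] vE; have [C CP] := IH w wp vE.
  exists (C + (`|l u w| + `|r u w|)) => t t0.
  have := CP t t0; have /andP[] := in_window xsol t0 Euw.
  have := ler_norm (r u w); have := ler_norm (- l u w); rewrite normrN.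
  have := normr_ge0 (l u w); have := normr_ge0 (r u w).
  by rewrite !ler_norml; lra.
have [C CP] := choice H.
exists (\big[Order.max/0]_p C p) => t t0 i k.
exact: le_trans (CP (i, k) t t0) (le_bigmax _ _ _).
Qed.

(** All nodes have the same displacement up to [2 * C]. Comparing [x] with its translate by [s]
    therefore makes the displacement of one node quasi-additive in time, and the other nodes follow
    it. *)
Lemma linear_drift : strongly_connected E ->
  exists c D, forall t, 0 <= t -> forall k, `|x t k - c * t| <= D.
Proof.
move=> Econn; have [C CP] := differences_bounded Econn.
have [k0|N0] := pickP 'I_N; last by exists 0, 0 => t _ k; have := N0 k.
have xc : {within `[0, 1], continuous (fun t => x t k0)}.
  apply: derivable_within_continuous => t; rewrite in_itv /= => /andP[t0 _].
  by have [] := solves xsol t0 k0.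
have [t1 _ t1P] := EVT_max (@ler01 R) xc; have [t2 _ t2P] := EVT_min (@ler01 R) xc.
have [||c [D DP]] := @quasi_additive_linear R (fun t => x t k0 - x 0 k0) (2 * C)
  (`|x t1 k0 - x 0 k0| + `|x t2 k0 - x 0 k0|).
- move=> s t s0 t0.
  have H k : `|(x s k - x 0 k) - (x s k0 - x 0 k0)| <= 2 * C.
    by have := CP s s0 k k0; have := CP 0 (lexx _) k k0; rewrite !ler_norml; lra.
  have h1 := @solution_nonexpansive s 0 (x s k0 - x 0 k0 + 2 * C) s0 (lexx _)
    ltac:(move=> k; have := H k; rewrite ler_norml; lra) t t0 k0.
  have h2 := @solution_nonexpansive 0 s (2 * C - (x s k0 - x 0 k0)) (lexx _) s0
    ltac:(move=> k; have := H k; rewrite ler_norml; lra) t t0 k0.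
  by move: h1 h2; rewrite add0r ler_norml; lra.
- move=> t t01; have tin : t \in `[0, 1] by rewrite in_itv.
  have := t1P t tin; have := t2P t tin.
  have := ler_norm (x t1 k0 - x 0 k0); have := ler_norm (- (x t2 k0 - x 0 k0)).
  rewrite normrN; have := normr_ge0 (x t1 k0 - x 0 k0).
  by have := normr_ge0 (x t2 k0 - x 0 k0); rewrite ler_norml; lra.
exists c, (D + `|x 0 k0| + C) => t t0 k.
have := DP t t0; have := CP t t0 k k0; have := ler_norm (x 0 k0).
by have := ler_norm (- x 0 k0); rewrite normrN !ler_norml; lra.
Qed.

Lemma remove_drift c :
  window_solution E l r f (fun k => om k - c) (fun t k => x t k - c * t).
Proof.
have e t i k : x t i - c * t - (x t k - c * t) = x t i - x t k by lra.
split.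
- exact: coupling_incr xsol.
- exact: coupling_cont xsol.
- by move=> t t0 k i Eki; rewrite e; exact: (in_window xsol).
- move=> t t0 k.
  have -> : kuramoto_rhs E (fun k => om k - c) f (fun k => x t k - c * t) k =
      kuramoto_rhs E om f (x t) k - c.
    rewrite /kuramoto_rhs addrAC; congr (_ + _ - _).
    by apply: eq_bigr => i _; rewrite e.
  apply: is_deriveB; first exact: (solves xsol).
  by apply: is_derive_eq; rewrite /GRing.scale /= !mulr1.
Qed.

(** The modulus of continuity at time 0 persists by nonexpansiveness, applied to [x] and its
    translate by [h]; velocities may be unbounded. *)
Lemma solution_uniformly_continuous e : 0 < e -> exists2 d, 0 < d &
  forall t h, 0 <= t -> 0 <= h <= d -> forall k, `|x (t + h) k - x t k| <= e.
Proof.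
move=> e0; have [d d0 dP] : exists2 d : R, 0 < d & forall k s, 0 < s <= d ->
    `|x s k - x 0 k| <= e.
  apply: near0_forall => k; have [d d0 dP] := solution_continuous k (lexx 0) e0.
  by exists d => // s /andP[s0 sd]; apply: dP; rewrite subr0 gtr0_norm.
exists d => // t h t0 /andP[]; rewrite le_eqVlt => /orP[/eqP<- _ k|h0 hd k].
  by rewrite addr0 subrr normr0 ltW.
have := @solution_nonexpansive_norm h 0 e (ltW h0) (lexx _)
  ltac:(move=> k'; apply: dP; by rewrite h0) t t0 k.
by rewrite add0r (addrC h).
Qed.

Lemma limit_curve_uniformly_continuous y : limit_curve x y ->
  forall e, 0 < e -> exists2 d, 0 < d &
  forall t h, 0 <= t -> 0 <= h <= d -> forall k, `|y (t + h) k - y t k| <= e.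
Proof.
move=> yx e e0.
have [d d0 dP] := @solution_uniformly_continuous (e / 3) ltac:(lra).
exists d => // t h t0 hd k; have [s ] := yx (e / 3) 0 ltac:(lra).
rewrite maxxx => s0 sP.
have := dP (s + t) h ltac:(lra) hd k.
have := sP t t0 k; have := sP (t + h) ltac:(case/andP: hd; lra) k.
by rewrite addrA !ler_norml; lra.
Qed.

Lemma limit_curve_window y : limit_curve x y ->
  forall t, 0 <= t -> forall k i, E k i -> l k i <= y t i - y t k <= r k i.
Proof.
move=> yx t t0 k i Eki.
suff H e : 0 < e -> l k i <= y t i - y t k + e /\ y t i - y t k <= r k i + e.
  by apply/andP; split; apply/ler_addgt0Pr => e /H[].
move=> e0; have [s ] := yx (e / 2) 0 ltac:(lra); rewrite maxxx => s0 sP.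
have := sP t t0 k; have := sP t t0 i.
have /andP[] := in_window xsol (t := s + t) ltac:(lra) Eki.
by rewrite !ler_norml; lra.
Qed.

(** This replaces the differential equation for limit curves: the mean value theorem is applied to a
    close translate of [x], whose differences [u] are strictly inside the windows. As [h0] does not
    depend on [e'], the error can tend to 0 with [h] fixed. *)
Lemma limit_curve_increment y tau k e : limit_curve x y -> 0 <= tau -> 0 < e ->
  exists2 h0, 0 < h0 & forall h, 0 < h <= h0 -> forall e', 0 < e' ->
    exists u : 'I_N -> R,
    [/\ forall i, E k i -> l k i < u i < r k i,
        forall i, `|u i - (y tau i - y tau k)| <= e &
        `|y (tau + h) k - y tau k - (om k + \sum_(i < N | E k i) f k i (u i)) * h| <= e'].
Proof.
move=> yx tau0 e0.
have [h0 h00 h0P] := limit_curve_uniformly_continuous yx (e := e / 4) ltac:(lra).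
exists h0 => // h /andP[hh0 hh] e' e'0.
(* The [e / 4] adds to the modulus of continuity to give [e / 2] per node; the [e' / 2] is spent at
   each end of the increment. *)
have [s ] := yx (Num.min (e / 4) (e' / 2)) 0 ltac:(rewrite lt_min; lra).
rewrite maxxx => s0 sP.
have [xi] := @MVT R (fun t => x t k) (fun t => kuramoto_rhs E om f (x t) k)
  (s + tau) (s + tau + h) ltac:(lra)
  ltac:(move=> t; rewrite in_itv /= => /andP[? _]; apply: (solves xsol); lra)
  ltac:(apply: derivable_within_continuous => t; rewrite in_itv /= => /andP[? _];
        by have [] := solves xsol (t := t) ltac:(lra) k).
rewrite in_itv /= => /andP[xi1 xi2] xiE.
exists (fun i => x xi i - x xi k); split.
- by move=> i Eki; apply: (in_window xsol) => //; lra.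
- move=> i; pose h' := xi - (s + tau).
  have hb j : `|x xi j - y tau j| <= e / 2.
    have := h0P tau h' tau0 ltac:(rewrite /h'; apply/andP; split; lra) j.
    have := sP (tau + h') ltac:(rewrite /h'; lra) j.
    have -> : s + (tau + h') = xi by rewrite /h'; lra.
    by rewrite le_min => /andP[+ _]; rewrite !ler_norml; lra.
  by have := hb i; have := hb k; rewrite !ler_norml; lra.
- move: xiE; rewrite -/(kuramoto_rhs E om f (x xi) k).
  have -> : s + tau + h - (s + tau) = h by lra.
  move=> <-; have := sP (tau + h) ltac:(lra) k; have := sP tau tau0 k.
  rewrite !le_min !addrA => /andP[_ +] /andP[_ +].
  by rewrite !ler_norml; lra.
Qed.

(** One-sided bounds on the forces suffice, so neighbours at a window end, where the coupling may
    have no finite limit, are allowed. *)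
Lemma limit_curve_le y k tau (U : 'I_N -> R) : limit_curve x y -> 0 <= tau ->
  (forall i, E k i -> exists2 d, 0 < d & forall u, l k i < u < r k i ->
     u <= y tau i - y tau k + d -> f k i u <= U i) ->
  exists2 h0, 0 < h0 & forall h, 0 < h <= h0 ->
    y (tau + h) k <= y tau k + (om k + \sum_(i < N | E k i) U i) * h.
Proof.
move=> yx tau0 H.
have [d d0 dP] : exists2 d : R, 0 < d & forall i s, 0 < s <= d -> E k i ->
    forall u, l k i < u < r k i -> u <= y tau i - y tau k + s -> f k i u <= U i.
  apply: near0_forall => i; have [Eki|] := boolP (E k i); last by exists 1.
  have [d d0 dP] := H i Eki; exists d => // s /andP[_ sd] _ u lur us.
  by apply: dP => //; lra.
have [h0 h00 h0P] := limit_curve_increment k yx tau0 d0.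
exists h0 => // h hh; apply/ler_addgt0Pr => e e0.
have [u [ulr ud ue]] := h0P h hh e e0.
have : (om k + \sum_(i < N | E k i) f k i (u i)) * h <=
       (om k + \sum_(i < N | E k i) U i) * h.
  rewrite ler_pM2r; last by case/andP: hh.
  rewrite lerD2l; apply: ler_sum => i Eki; apply: (dP i d) => //.
  - by rewrite d0 lexx.
  - exact: ulr.
  - by have := ud i; rewrite ler_norml; lra.
by move: ue; rewrite ler_norml; lra.
Qed.

Lemma limit_curve_ge y k tau (U : 'I_N -> R) : limit_curve x y -> 0 <= tau ->
  (forall i, E k i -> exists2 d, 0 < d & forall u, l k i < u < r k i ->
     y tau i - y tau k - d <= u -> U i <= f k i u) ->
  exists2 h0, 0 < h0 & forall h, 0 < h <= h0 ->
    y tau k + (om k + \sum_(i < N | E k i) U i) * h <= y (tau + h) k.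
Proof.
move=> yx tau0 H.
have [d d0 dP] : exists2 d : R, 0 < d & forall i s, 0 < s <= d -> E k i ->
    forall u, l k i < u < r k i -> y tau i - y tau k - s <= u -> U i <= f k i u.
  apply: near0_forall => i; have [Eki|] := boolP (E k i); last by exists 1.
  have [d d0 dP] := H i Eki; exists d => // s /andP[_ sd] _ u lur us.
  by apply: dP => //; lra.
have [h0 h00 h0P] := limit_curve_increment k yx tau0 d0.
exists h0 => // h hh; apply/ler_addgt0Pr => e e0.
have [u [ulr ud ue]] := h0P h hh e e0.
have : (om k + \sum_(i < N | E k i) U i) * h <=
       (om k + \sum_(i < N | E k i) f k i (u i)) * h.
  rewrite ler_pM2r; last by case/andP: hh.
  rewrite lerD2l; apply: ler_sum => i Eki; apply: (dP i d) => //.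
  - by rewrite d0 lexx.
  - exact: ulr.
  - by have := ud i; rewrite ler_norml; lra.
by move: ue; rewrite ler_norml; lra.
Qed.
End WindowSolution.

(** * Compactness, existence of limit curves and almost periodicity *)

Lemma bounded_cluster_point (R : realType) (N : nat) (u : nat -> 'I_N -> R) (B : R) :
  (forall n k, `|u n k| <= B) ->
  exists p : 'I_N -> R, forall e n0, 0 < e ->
    exists2 n, (n0 <= n)%N & forall k, `|u n k - p k| <= e.
Proof.
move=> uB; pose w n : 'rV[R]_N := \row_k u n k.
have [|p [_ pc]] := @rV_compact R N (fun=> `[- B, B]%classic) (fun=> @segment_compact R _ _)
    (w @ \oo).
  exists 0%N => // n _ i /=; rewrite mxE in_itv /= -ler_norml; exact: uB.
exists (fun k => p ord0 k) => e n0 e0.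
have := pc (w @` [set n | (n0 <= n)%N]) (ball p e).
case.
- by exists n0 => // n /= n0n; exists n.
- exact: nbhsx_ballx.
move=> _ [[n /= n0n <-] /= bp]; exists n => // k.
by have := bp.2 ord0 k; rewrite /ball /= mxE distrC => /ltW.
Qed.

Lemma null_sequence_exists (R : realType) : exists d : nat -> R,
  [/\ forall n, 0 < d n, forall n m, (n <= m)%N -> d m <= d n &
      forall e, 0 < e -> exists n, d n <= e].
Proof.
exists (fun n => (n.+1%:R)^-1); split=> [n|n m nm|e e0].
- by rewrite invr_gt0 ltr0n.
- by rewrite lef_pV2 ?posrE ?ltr0n// ler_nat.
exists (Num.trunc e^-1).
have e1 : 0 < e^-1 by rewrite invr_gt0.
have /andP[_ h] := truncn_itv (ltW e1).
by rewrite -[leRHS]invrK lef_pV2 ?posrE ?ltr0n// ltW.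
Qed.

Section BoundedSolution.
Variables (R : realType) (N : nat) (E : rel 'I_N).
Variables (l r : 'I_N -> 'I_N -> R) (f : 'I_N -> 'I_N -> R -> R).
Variables (om : 'I_N -> R) (x : R -> 'I_N -> R) (B : R).
Hypothesis xsol : window_solution E l r f om x.
Hypothesis xB : forall t, 0 <= t -> forall k, `|x t k| <= B.

(** Times at which node [k0] approaches [v] are refined by compactness until all nodes converge;
    nonexpansiveness then makes the translates uniformly Cauchy. *)
Lemma limit_curve_through k0 v :
  (forall e T, 0 < e -> exists2 t, T <= t & `|x t k0 - v| <= e) ->
  exists2 y, limit_curve x y & y 0 k0 = v.
Proof.
move=> Hv; have [d [d0 dmono dsmall]] := null_sequence_exists R.
have tn_ex n : exists t : R, n%:R <= t /\ `|x t k0 - v| <= (d n).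
  by have [t nt tP] := Hv (d n) n%:R (d0 n); exists t.
have [tn tnP] := choice tn_ex.
have tn0 n : 0 <= tn n by apply: le_trans (tnP n).1.
have [p pP] := bounded_cluster_point (u := fun n => x (tn n)) (fun n k => xB (tn0 n) k).
have sn_ex n : exists s : R, [/\ n%:R <= s, `|x s k0 - v| <= (d n) &
    forall k, `|x s k - p k| <= (d n)].
  have [m nm mP] := pP (d n) n (d0 n); exists (tn m).
  have [h1 h2] := tnP m; split => //.
    by apply: le_trans h1; rewrite ler_nat.
  by apply: le_trans h2 _; exact: dmono.
have [sn snP] := choice sn_ex.
have sn0 n : 0 <= sn n by have [h _ _] := snP n; apply: le_trans h.
(* Both translates start within [d n] of [p], and their distance never grows. *)
have sncauchy n m t k : (n <= m)%N -> 0 <= t ->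
    `|x (sn n + t) k - x (sn m + t) k| <= 2 * (d n).
  move=> nm t0; apply: (solution_nonexpansive_norm xsol) => // {}k.
  have [_ _ /(_ k) h1] := snP n; have [_ _ /(_ k) h2] := snP m.
  have h3 := dmono _ _ nm.
  by move: h1 h2 h3; rewrite !ler_norml; lra.
pose y t k := lim (x (sn n + t) k @[n --> \oo]).
have ycvg t k : 0 <= t -> x (sn n + t) k @[n --> \oo] --> y t k.
  move=> t0; apply/cauchy_cvgP/cauchyP => e e0.
  have [n nP] := dsmall (e / 3) ltac:(lra).
  exists (x (sn n + t) k); exists n => // m /= nm.
  by apply: le_lt_trans (sncauchy n m t k nm t0) _; lra.
have ydist n t k : 0 <= t -> `|y t k - x (sn n + t) k| <= 2 * (d n).
  move=> t0; apply/ler_addgt0Pr => e e0.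
  have /cvgr_dist_lt/(_ _ e0)[m _ mP] := ycvg t k t0.
  have := mP (maxn n m) (leq_maxr _ _); have := sncauchy n (maxn n m) t k (leq_maxl _ _) t0.
  by rewrite ltr_norml !ler_norml; lra.
exists y.
  move=> e T e0; have [n nP] := dsmall (e / 2) ltac:(lra).
  have [m mP] : exists m : nat, T <= m%:R.
    exists (Num.trunc `|T|).+1; apply: le_trans (ler_norm _) _.
    by have /andP[_ /ltW] := truncn_itv (normr_ge0 T).
  exists (sn (maxn n m)).
    rewrite ge_max sn0 /=; have [h _ _] := snP (maxn n m); apply: le_trans h.
    by apply: le_trans mP _; rewrite ler_nat leq_maxr.
  move=> t t0 k; apply: le_trans (ydist _ _ _ t0) _.
  have : d (maxn n m) <= d n by exact/dmono/leq_maxl.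
  by lra.
apply/eqP; rewrite -subr_eq0 -normr_le0; apply/ler_addgt0Pr => e e0; rewrite add0r.
have [n nP] := dsmall (e / 3) ltac:(lra).
have := ydist n 0 k0 (lexx _); have [_ + _] := snP n.
by rewrite addr0 !ler_norml; lra.
Qed.

(** Two distant integer times with nearly equal configurations exist by compactness; by
    nonexpansiveness their difference is an almost period from then on. *)
Lemma almost_periodic e T : 0 < e ->
  exists2 s1, 0 <= s1 & exists2 tau, T <= tau & 0 <= tau /\
    forall t, s1 <= t -> forall k, `|x (t + tau) k - x t k| <= e.
Proof.
move=> e0.
have [p pP] := bounded_cluster_point (u := fun n => x n%:R) (fun n k => xB (ler0n _ n) k).
have [n _ nP] := pP (e / 2) 0%N ltac:(lra).
(* The shift of the index makes [m - n] at least the absolute value of [T]. *)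
have [m nm mP] := pP (e / 2) (n + (Num.trunc `|T|).+1)%N ltac:(lra).
have TT : `|T| <= (Num.trunc `|T|).+1%:R by have /andP[_ /ltW] := truncn_itv (normr_ge0 T).
have mn : n%:R + `|T| <= m%:R :> R.
  by apply: (@le_trans _ _ (n + (Num.trunc `|T|).+1)%:R); [rewrite natrD lerD2l|rewrite ler_nat].
exists n%:R => //; exists (m%:R - n%:R).
  by have := ler_norm T; lra.
split; first by have := normr_ge0 T; lra.
move=> t nt k.
have := @solution_nonexpansive_norm _ _ _ _ _ _ _ _ xsol m%:R n%:R e (ler0n _ _) (ler0n _ _)
  ltac:(move=> k'; have := nP k'; have := mP k'; rewrite !ler_norml; lra) (t - n%:R) ltac:(lra) k.
have -> : m%:R + (t - n%:R) = t + (m%:R - n%:R) by lra.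
by have -> : n%:R + (t - n%:R) = t by lra.
Qed.

(** If all gaps had dropped below [M - e] at time [t], they would stay below it up to a small error;
    but an almost period later than [t] brings the gap at [k0] back near [M]. *)
Lemma limit_curves_isometric y z k0 M : limit_curve x y -> limit_curve x z ->
  y 0 k0 - z 0 k0 = M -> forall t, 0 <= t -> forall e, 0 < e ->
  exists k, M - e <= y t k - z t k.
Proof.
move=> yx zx yz t t0 e e0; apply: contrapT => /forallNP H.
have {}H k : y t k - z t k <= M - e.
  by rewrite leNgt; apply/negP => h; apply: (H k); exact: ltW.
have [s1 s10 [tau ttau [tau0 tauP]]] := @almost_periodic (e / 8) t ltac:(lra).
have [s ] := yx (e / 8) s1 ltac:(lra); rewrite ge_max => /andP[s0 s1s] sP.
have [s' ] := zx (e / 8) s1 ltac:(lra); rewrite ge_max => /andP[s'0 s1s'] s'P.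
have := @solution_nonexpansive _ _ _ _ _ _ _ _ xsol (s + t) (s' + t) (M - e + e / 4)
  ltac:(lra) ltac:(lra)
  ltac:(move=> k; have := H k; have := sP t t0 k; have := s'P t t0 k; rewrite !ler_norml; lra)
  (tau - t) ltac:(lra) k0.
have -> : s + t + (tau - t) = s + tau by lra.
have -> : s' + t + (tau - t) = s' + tau by lra.
have := tauP s s1s k0; have := tauP s' s1s' k0.
have := sP 0 (lexx _) k0; have := s'P 0 (lexx _) k0.
by rewrite !addr0 !ler_norml; lra.
Qed.
End BoundedSolution.

(** * Balance of forces at the extremal nodes, and convergence *)

Lemma sum_shift_bound (R : realType) (N : nat) (P : pred 'I_N) (F : 'I_N -> R) (e : R) :
  0 <= e ->
  \sum_(i < N | P i) (F i + e / N.+1%:R) <= \sum_(i < N | P i) F i + e.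
Proof.
move=> e0; rewrite big_split /= lerD2l sumr_const -[_ *+ #|_|]mulr_natr mulrAC.
rewrite ler_pdivrMr ?ltr0n// ler_wpM2l// ler_nat.
by apply: leq_trans (max_card _) _; rewrite card_ord.
Qed.

Section Convergence.
Variables (R : realType) (N : nat) (E : rel 'I_N).
Variables (l r : 'I_N -> 'I_N -> R) (f : 'I_N -> 'I_N -> R -> R).
Variables (om : 'I_N -> R) (x : R -> 'I_N -> R).
Hypothesis xsol : window_solution E l r f om x.

(** A negative total would make [y] decrease strictly right after [t0], although the node is at
    rest. *)
Lemma stationary_le y k t0 L (U : 'I_N -> R) : limit_curve x y -> 0 <= t0 -> 0 < L ->
  (forall h, 0 < h <= L -> y (t0 + h) k = y t0 k) ->
  (forall i, E k i -> exists2 d, 0 < d & forall u, l k i < u < r k i ->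
     u <= y t0 i - y t0 k + d -> f k i u <= U i) ->
  0 <= om k + \sum_(i < N | E k i) U i.
Proof.
move=> yx t00 L0 yk H; have [h0 h00 h0P] := limit_curve_le xsol yx t00 H.
pose h := Num.min h0 L.
have hp : 0 < h by rewrite lt_min h00.
have := h0P h ltac:(by rewrite hp ge_min lexx).
rewrite yk ?hp ?ge_min ?lexx ?orbT// lerDl => hh.
by rewrite -(pmulr_lge0 _ hp).
Qed.

Lemma stationary_ge y k t0 L (U : 'I_N -> R) : limit_curve x y -> 0 <= t0 -> 0 < L ->
  (forall h, 0 < h <= L -> y (t0 + h) k = y t0 k) ->
  (forall i, E k i -> exists2 d, 0 < d & forall u, l k i < u < r k i ->
     y t0 i - y t0 k - d <= u -> U i <= f k i u) ->
  om k + \sum_(i < N | E k i) U i <= 0.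
Proof.
move=> yx t00 L0 yk H; have [h0 h00 h0P] := limit_curve_ge xsol yx t00 H.
pose h := Num.min h0 L.
have hp : 0 < h by rewrite lt_min h00.
have := h0P h ltac:(by rewrite hp ge_min lexx).
rewrite yk ?hp ?ge_min ?lexx ?orbT// gerDl => hh.
by rewrite -(pmulr_lle0 _ hp).
Qed.

(* The nodes of [A] are those where the gap between [y] and [z] is maximal.  If no
   neighbour of [k] in [A] sits at the upper end of its window, then the forces
   on [k] from above are bounded; as [k] is at rest, those from below are bounded
   too, and a neighbour outside [A] would pull [k] down more on [y] than on [z]. *)
Lemma free_node_forces y z (A : {set 'I_N}) (a b : 'I_N -> R) (M t0 L : R) k :
  limit_curve x y -> limit_curve x z -> 0 <= t0 -> 0 < L ->
  (forall i t, i \in A -> t0 <= t <= t0 + L -> y t i = b i /\ z t i = a i) ->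
  (forall i, i \in A -> b i - a i = M) ->
  (forall i, i \notin A -> y t0 i - z t0 i < M) ->
  k \in A -> (forall i, i \in A -> E k i -> b i - b k < r k i) ->
  exists phi : 'I_N -> R, [/\ forall i, E k i -> i \in A,
    0 <= om k + \sum_(i < N | E k i) phi i &
    forall i, E k i -> forall e, 0 < e -> exists2 d, 0 < d &
      forall u, l k i < u < r k i -> b i - b k - d <= u -> phi i - e <= f k i u].
Proof.
move=> yx zx t00 L0 Aab AM AnM kA kfree.
have t0in : t0 <= t0 <= t0 + L by rewrite lexx /=; lra.
have yE i : i \in A -> y t0 i = b i by move=> iA; have [] := Aab i t0 iA t0in.
have zE i : i \in A -> z t0 i = a i by move=> iA; have [] := Aab i t0 iA t0in.
have yst h : 0 < h <= L -> y (t0 + h) k = y t0 k.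
  move=> /andP[h0 hL]; rewrite yE//.
  by have [] := Aab k (t0 + h) kA ltac:(apply/andP; split; lra).
have zst h : 0 < h <= L -> z (t0 + h) k = z t0 k.
  move=> /andP[h0 hL]; rewrite zE//.
  by have [] := Aab k (t0 + h) kA ltac:(apply/andP; split; lra).
have ywin i := limit_curve_window xsol yx t00 (k := k) (i := i).
have zwin i := limit_curve_window xsol zx t00 (k := k) (i := i).
pose Y i := y t0 i - y t0 k; pose Z i := z t0 i - z t0 k.
have YA i : i \in A -> Y i = b i - b k by move=> iA; rewrite /Y !yE.
have ZA i : i \in A -> Z i = b i - b k.
  by move=> iA; rewrite /Z !zE//; have := AM i iA; have := AM k kA; lra.
have YZ i : i \notin A -> Y i < Z i.
  move=> iA; have := AnM i iA; rewrite /Y /Z.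
  by have := AM k kA; rewrite -yE// -zE//; lra.
(* Third points between the two differences: [l <= Y < p < q < Z <= r], so both are interior, [f] at
   [p] bounds the force along [y] from above, and [f] at [q] bounds the one along [z] from below. *)
pose p i := Y i + (Z i - Y i) / 3; pose q i := Z i - (Z i - Y i) / 3.
have pwin i : E k i -> i \notin A -> l k i < p i < r k i.
  move=> Eki iA; have := YZ i iA; have /andP[h1 _] := ywin i Eki.
  have /andP[_ h2] := zwin i Eki; rewrite -/(Y i) -/(Z i) in h1 h2.
  by rewrite /p => ?; apply/andP; split; lra.
have qwin i : E k i -> i \notin A -> l k i < q i < r k i.
  move=> Eki iA; have := YZ i iA; have /andP[h1 _] := ywin i Eki.
  have /andP[_ h2] := zwin i Eki; rewrite -/(Y i) -/(Z i) in h1 h2.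
  by rewrite /q => ?; apply/andP; split; lra.
have pbnd i : E k i -> i \notin A -> exists2 d, 0 < d & forall u, l k i < u < r k i ->
    u <= y t0 i - y t0 k + d -> f k i u <= f k i (p i).
  move=> Eki iA; exists ((Z i - Y i) / 3); first by have := YZ i iA; lra.
  by move=> u lur; rewrite -/(Y i) => up; apply: (coupling_homo xsol) => //; exact: pwin.
have qbnd i : E k i -> i \notin A -> exists2 d, 0 < d & forall u, l k i < u < r k i ->
    z t0 i - z t0 k - d <= u -> f k i (q i) <= f k i u.
  move=> Eki iA; exists ((Z i - Y i) / 3); first by have := YZ i iA; lra.
  by move=> u lur; rewrite -/(Z i) => up; apply: (coupling_homo xsol) => //; exact: qwin.
have [U UP] : {U : 'I_N -> R & forall i, E k i -> exists2 d, 0 < d &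
    forall u, l k i < u < r k i -> u <= y t0 i - y t0 k + d -> f k i u <= U i}.
  apply: (choice (P := fun i Ui => E k i -> exists2 d, 0 < d &
    forall u, l k i < u < r k i -> u <= y t0 i - y t0 k + d -> f k i u <= Ui)) => i.
  have [Eki|] := boolP (E k i); last by exists 0.
  have [iA|iA] := boolP (i \in A); last by exists (f k i (p i)) => _; exact: pbnd.
  have := kfree i iA Eki; have /andP[] := ywin i Eki; rewrite -/(Y i) YA// => h1 _ h2.
  exists (f k i ((b i - b k + r k i) / 2)) => _.
  exists ((r k i - (b i - b k)) / 2); first lra.
  move=> u lur ub; apply: (coupling_homo xsol) => //; last lra.
  by apply/andP; split; lra.
(* If the neighbour [i] sits at the lower end, any value [f k i u0] bounds its force from above;
   rest of [k] forces this value to outweigh the bounds [U] of the others, which yields the [K] of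
   [monotone_value]. *)
have fbelow i : i \in A -> E k i -> b i - b k = l k i ->
    exists K, forall u, l k i < u < r k i -> K <= f k i u.
  move=> iA Eki bil; exists (- (om k + \sum_(j < N | E k j && (j != i)) U j)) => u0 u0lr.
  have := @stationary_le y k t0 L (fun j => if j == i then f k i u0 else U j) yx t00 L0 yst.
  rewrite (bigD1 i)//= eqxx.
  rewrite (eq_bigr U); last by move=> j /andP[_ /negPf->].
  suff H : forall j, E k j -> exists2 d, 0 < d & forall u, l k j < u < r k j ->
     u <= y t0 j - y t0 k + d -> f k j u <= (if j == i then f k i u0 else U j).
    by move=> /(_ H); lra.
  move=> j Ekj; have [->|_] := eqVneq j i; last exact: UP.
  have /andP[lu0 _] := u0lr; exists (u0 - l k i); first lra.
  move=> u lur; rewrite -/(Y i) YA// bil => uu.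
  by apply: (coupling_homo xsol) => //; lra.
have [phi phiP] : {phi : 'I_N -> R & forall i, i \in A -> E k i -> forall e, 0 < e ->
    exists2 d, 0 < d & forall u, l k i < u < r k i ->
    (b i - b k - d <= u -> phi i - e <= f k i u) /\
    (u <= b i - b k + d -> f k i u <= phi i + e)}.
  apply: (choice (P := fun i ph => i \in A -> E k i -> forall e, 0 < e ->
    exists2 d, 0 < d & forall u, l k i < u < r k i ->
    (b i - b k - d <= u -> ph - e <= f k i u) /\
    (u <= b i - b k + d -> f k i u <= ph + e))) => i.
  have [Eki|] := boolP (E k i); last by exists 0.
  have [iA|] := boolP (i \in A); last by exists 0.
  have [||||ph phP] := @monotone_value R (l k i) (r k i) (b i - b k) (f k i).
  - exact: coupling_homo xsol _ _ Eki.
  - exact: coupling_cont xsol _ _ Eki.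
  - have := kfree i iA Eki; have /andP[] := ywin i Eki; rewrite -/(Y i) YA// => h1 _ h2.
    by rewrite h1.
  - exact: fbelow.
  by exists ph => _ _; exact: phP.
(* A neighbour outside [A] makes the total force along [z] exceed that along [y] by at least [g], up
   to an error [2 * e = 2 * g / 3]; both cannot then balance. *)
have EA i : E k i -> i \in A.
  move=> Eki; apply: contrapT => /negP iA.
  have g0 : 0 < f k i (q i) - f k i (p i).
    rewrite subr_gt0; apply: (coupling_incr xsol) => //; [exact: pwin|exact: qwin|].
    by have := YZ i iA; rewrite /p /q; lra.
  set g := f k i (q i) - f k i (p i) in g0.
  pose e := g / 3.
  have eN : 0 < e / N.+1%:R by apply: divr_gt0; [rewrite /e; lra | rewrite ltr0n].
  have h1 := @stationary_le y k t0 L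
    (fun j => if j \in A then phi j + e / N.+1%:R else f k j (p j)) yx t00 L0 yst
    ltac:(move=> j Ekj; have [jA|jA] := boolP (j \in A); last exact: pbnd;
      have [d d0 dP] := phiP j jA Ekj _ eN; exists d => // u lur;
      rewrite -/(Y j) YA// => ud; exact: (dP u lur).2).
  have h2 := @stationary_ge z k t0 L
    (fun j => if j \in A then phi j - e / N.+1%:R else f k j (q j)) zx t00 L0 zst
    ltac:(move=> j Ekj; have [jA|jA] := boolP (j \in A); last exact: qbnd;
      have [d d0 dP] := phiP j jA Ekj _ eN; exists d => // u lur;
      rewrite -/(Z j) ZA// => ud; exact: (dP u lur).1).
  have : \sum_(j < N | E k j) (if j \in A then phi j + e / N.+1%:R else f k j (p j)) <=
         \sum_(j < N | E k j) ((if j \in A then phi j - e / N.+1%:R else f k j (q j)) +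
            (if j == i then - g else 0) + 2 * e / N.+1%:R).
    apply: ler_sum => j Ekj; have [jA|jA] := boolP (j \in A).
      have -> : (j == i) = false by apply: contraNF iA => /eqP<-.
      by rewrite -mulrA; move: (e / _) => e1 /=; lra.
    have [->|_] := eqVneq j i.
      by rewrite /g -mulrA; move: (e / _) eN => e1 e10 /=; lra.
    have : f k j (p j) <= f k j (q j).
      apply: (coupling_homo xsol) => //; [exact: pwin|exact: qwin|].
      by have := YZ j jA; rewrite /p /q; lra.
    by rewrite -mulrA; move: (e / _) eN => e1 e10 /=; lra.
  have := @sum_shift_bound R N (E k) (fun j =>
    (if j \in A then phi j - e / N.+1%:R else f k j (q j)) +
            (if j == i then - g else 0)) (2 * e) ltac:(rewrite /e; lra).
  rewrite [X in _ <= X + _]big_split /=.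
  have -> : \sum_(j < N | E k j) (if j == i then - g else 0) = - g.
    by rewrite (bigD1 i)//= eqxx big1 ?addr0// => j /andP[_ /negPf->].
  by rewrite /e in h1 h2 *; lra.
exists phi; split => // [|i Eki e e0].
  apply/ler_addgt0Pr => e e0.
  have eN : 0 < e / N.+1%:R by apply: divr_gt0 => //; rewrite ltr0n.
  have := @stationary_le y k t0 L (fun j => phi j + e / N.+1%:R) yx t00 L0 yst
    ltac:(move=> j Ekj; have jA := EA j Ekj;
      have [d d0 dP] := phiP j jA Ekj _ eN; exists d => // u lur;
      rewrite -/(Y j) YA// => ud; exact: (dP u lur).2).
  by have := sum_shift_bound (E k) phi (ltW e0); lra.
have [d d0 dP] := phiP i (EA i Eki) Eki e e0.
by exists d => // u lur; exact: (dP u lur).1.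
Qed.
End Convergence.

Lemma bounded_solution_converges (R : realType) (N : nat) (E : rel 'I_N)
    (l r : 'I_N -> 'I_N -> R) (f : 'I_N -> 'I_N -> R -> R)
    (om : 'I_N -> R) (x : R -> 'I_N -> R) (B : R) :
  window_solution E l r f om x ->
  (forall t, 0 <= t -> forall k, `|x t k| <= B) ->
  exists p : 'I_N -> R, forall e, 0 < e -> exists T, forall t, T <= t ->
    forall k, `|x t k - p k| <= e.
Proof.
move=> xsol xB.
have [j0 _|N0] := pickP 'I_N; last by exists (fun=> 0) => e _; exists 0 => t _ k; have := N0 k.
have [b bP] := choice (fun k => limsup_exists (g := fun t => x t k) (fun t t0 => xB t t0 k)).
(* Here [a k] is the limsup of [- x], so the liminf is [- a k] and [b k + a k] is the oscillation of
   node [k]. *)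
have [a aP] := choice (fun k => limsup_exists (g := fun t => - x t k) (B := B)
  (fun t t0 => eq_ind_r (fun u => u <= B) (xB t t0 k) (normrN (x t k)))).
pose k0 := [arg max_(k > j0) (b k + a k)]%O.
pose M := b k0 + a k0.
have leM k : b k + a k <= M by rewrite /M /k0; case: arg_maxP => // i _ /(_ k isT).
have [y yx y0] := limit_curve_through xsol xB (k0 := k0) (v := b k0) (bP k0).2.
have [z zx z0] : exists2 z, limit_curve x z & z 0 k0 = - a k0.
  apply: (limit_curve_through xsol xB) => e T e0; have [t Tt tP] := (aP k0).2 e T e0.
  by exists t => //; rewrite -normrN opprB addrC.
have yb t k : 0 <= t -> y t k <= b k.
  move=> t0; apply/ler_addgt0Pr => e e0.
  have [T T0 TP] := (bP k).1 (e / 2) ltac:(lra).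
  have [s ] := yx (e / 2) T ltac:(lra); rewrite ge_max => /andP[s0 Ts] sP.
  by have := sP t t0 k; have := TP (s + t) ltac:(lra); rewrite ler_norml; lra.
have za t k : 0 <= t -> - a k <= z t k.
  move=> t0; apply/ler_addgt0Pr => e e0.
  have [T T0 TP] := (aP k).1 (e / 2) ltac:(lra).
  have [s ] := zx (e / 2) T ltac:(lra); rewrite ge_max => /andP[s0 Ts] sP.
  by have := sP t t0 k; have := TP (s + t) ltac:(lra); rewrite ler_norml; lra.
have gapM t k : 0 <= t -> y t k - z t k <= M.
  by move=> t0; have := yb t k t0; have := za t k t0; have := leM k; lra.
pose A t := [set k | y t k - z t k == M]%SET.
have AP t k : 0 <= t -> k \in A t -> [/\ y t k = b k, z t k = - a k & b k + a k = M].
  move=> t0; rewrite inE => /eqP h.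
  by have := yb t k t0; have := za t k t0; have := leM k; split; lra.
have AnM t k : 0 <= t -> k \notin A t -> y t k - z t k < M.
  by move=> t0; rewrite inE => h; rewrite lt_neqAle h gapM.
have A_neq0 t : 0 <= t -> exists k, k \in A t.
  move=> t0; pose k1 := [arg max_(k > j0) (y t k - z t k)]%O.
  (* Some node comes within every [e] of [M], hence the maximising node attains it. *)
  exists k1; rewrite inE eq_le gapM//=; apply/ler_addgt0Pr => e e0.
  have [k kP] := limit_curves_isometric xsol xB yx zx (k0 := k0) (M := M)
    ltac:(rewrite y0 z0 opprK; done) t0 e0.
  have : y t k - z t k <= y t k1 - z t k1 by rewrite /k1; case: arg_maxP => // i _ /(_ k isT).
  lra.
have [t0 t00 t0min] : exists2 t0, 0 <= t0 & forall t, 0 <= t -> (#|A t0| <= #|A t|)%N.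
  have ex : exists n, `[< exists2 t, 0 <= t & #|A t| = n >].
    by exists #|A 0|; apply/asboolP; exists 0.
  have [n /asboolP[t t0 tn] nmin] := ex_minnP ex.
  by exists t => // u u0; rewrite tn; apply: nmin; apply/asboolP; exists u.
have yuc := limit_curve_uniformly_continuous xsol yx.
have zuc := limit_curve_uniformly_continuous xsol zx.
(* A strict gap stays strict for a short time, so [A] can only shrink after [t0]; minimality of its
   cardinality makes it constant. *)
have [L L0 LP] : exists2 L : R, 0 < L & forall k s, 0 < s <= L ->
    k \notin A t0 -> k \notin A (t0 + s).
  apply: near0_forall => k; have [kA|kA] := boolP (k \in A t0); first by exists 1.
  have gap0 := AnM t0 k t00 kA; pose g := M - (y t0 k - z t0 k).
  have [d d0 dP] := yuc (g / 3) ltac:(rewrite /g; lra).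
  have [d' d'0 d'P] := zuc (g / 3) ltac:(rewrite /g; lra).
  exists (Num.min d d'); first by rewrite lt_min d0.
  move=> s; rewrite le_min => /andP[s0 /andP[sd sd']] _.
  have := dP t0 s t00 ltac:(by rewrite ltW) k; have := d'P t0 s t00 ltac:(by rewrite ltW) k.
  rewrite inE !ler_norml /g => h1 h2; apply/eqP; lra.
have Aconst t : t0 <= t <= t0 + L -> A t = A t0.
  move=> /andP[t0t tL]; apply/eqP; rewrite eqEcard t0min ?andbT; last lra.
  have [->//|tt0] := eqVneq t t0.
  apply/fintype.subsetP => k; apply: contraLR => kA.
  have -> : t = t0 + (t - t0) by lra.
  apply: LP => //; apply/andP; split; last lra.
  by rewrite subr_gt0 lt_neqAle eq_sym tt0.
(* Free nodes have no neighbour in [A t0] at the upper end of its window. *)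
pose free k := (k \in A t0) && [forall i, (i \in A t0) && E k i ==> (b i - b k < r k i)].
have forces k : free k -> exists phi : 'I_N -> R, [/\ forall i, E k i -> i \in A t0,
    0 <= om k + \sum_(i < N | E k i) phi i &
    forall i, E k i -> forall e, 0 < e -> exists2 d, 0 < d &
      forall u, l k i < u < r k i -> b i - b k - d <= u -> phi i - e <= f k i u].
  move=> /andP[kA /forallP kfree].
  apply: (free_node_forces xsol yx zx t00 L0 (A := A t0) (a := fun k => - a k) (M := M)) => //.
  - move=> i t iA tin; have t_ge0 : 0 <= t by case/andP: tin; lra.
    by have [] := AP t i t_ge0 ltac:(by rewrite Aconst).
  - by move=> i iA; have [_ _] := AP t0 i t00 iA; lra.
  - by move=> i; exact: AnM.
  - by move=> i iA Eki; have /implyP := kfree i; apply; rewrite iA.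
pose g k t := b k - y (t0 + t) k.
(* A node at the upper end of a window is dominated by the neighbour blocking it, whose
   potential [b i - x 0 i] is larger because [x 0] lies strictly inside the window. *)
have maxfree t : 0 <= t -> exists2 k, free k & forall i, i \in A t0 -> g i t <= g k t.
  move=> t_ge0; have [k1 k1A] := A_neq0 t0 t00.
  pose km := [arg max_(i > k1 in A t0) g i t]%O.
  have [kmA kmmax] : km \in A t0 /\ forall i, i \in A t0 -> g i t <= g km t.
    by rewrite /km; case: arg_maxP.
  pose k2 := [arg max_(i > km | (i \in A t0) && (g i t == g km t)) (b i - x 0 i)]%O.
  have [/andP[k2A /eqP k2g] k2max] : (k2 \in A t0) && (g k2 t == g km t) /\
      forall i, (i \in A t0) && (g i t == g km t) -> b i - x 0 i <= b k2 - x 0 k2.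
    by rewrite /k2; case: arg_maxP => //; rewrite kmA /=.
  exists k2; last by move=> i iA; rewrite k2g; exact: kmmax.
  rewrite /free k2A; apply/forallP => i; apply/implyP => /andP[iA Ei].
  rewrite ltNge; apply/negP => blocked.
  have /andP[_ ywin] := limit_curve_window xsol yx (t := t0 + t) ltac:(lra) Ei.
  have /andP[_ xwin] := in_window xsol (lexx 0) Ei.
  have : g i t == g km t by rewrite eq_le kmmax//= -k2g /g; lra.
  by move=> h; have := k2max i ltac:(by rewrite iA); lra.
(* Where the drop [g] below [b] is largest among the free nodes, it is largest on all of [A t0] by
   [maxfree]. All differences to neighbours are then at least those of [b], so the force is at least
   [- e] and [g] cannot grow. *)
have frozen k : free k -> forall t, 0 <= t -> g k t <= 0.
  move=> kfree t t_ge0; apply: (@max_nonincreasing R 'I_N free g 0) => //.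
  - move=> {kfree}k _ {t_ge0}t t_ge0 e e0; have [d d0 dP] := yuc e e0.
    exists d => // s s0; rewrite ler_norml => /andP[h1 h2].
    have [ts|st] := leP t s.
      have := dP (t0 + t) (s - t) ltac:(lra) ltac:(apply/andP; split; lra) k.
      have -> : t0 + t + (s - t) = t0 + s by lra.
      by rewrite /g !ler_norml; lra.
    have := dP (t0 + s) (t - s) ltac:(lra) ltac:(apply/andP; split; lra) k.
    have -> : t0 + s + (t - s) = t0 + t by lra.
    by rewrite /g !ler_norml; lra.
  - move=> {kfree}k {t_ge0}t kfree t_ge0 kmax e e0.
    have [phi [EA phi0 phiP]] := forces k kfree.
    have [k1 k1free k1max] := maxfree t t_ge0.
    have {}kmax i : i \in A t0 -> g i t <= g k t.
      by move=> iA; exact: le_trans (k1max i iA) (kmax k1 k1free).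
    have eN : 0 < e / N.+1%:R by apply: divr_gt0 => //; rewrite ltr0n.
    have [|h h0 hP] := @limit_curve_ge _ _ _ _ _ _ _ _ xsol y k (t0 + t)
      (fun i => phi i - e / N.+1%:R) yx ltac:(lra).
      move=> i Eki; have [d d0 dP] := phiP i Eki _ eN; exists d => // u lur ud.
      by apply: dP => //; have := kmax i (EA i Eki); rewrite /g; lra.
    exists h => // s /andP[s0 sh]; have := hP s ltac:(by rewrite s0).
    have := sum_shift_bound (E k) (fun i => phi i - e / N.+1%:R) (ltW e0).
    under eq_bigr do rewrite subrK.
    move=> sum_ge.
    have : (- e) * s <= (om k + \sum_(i < N | E k i) (phi i - e / N.+1%:R)) * s.
      by rewrite ler_pM2r//; lra.
    by rewrite /g addrA; lra.
  - move=> {kfree}k /andP[kA _]; have [yk _ _] := AP t0 k t00 kA.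
    by rewrite /g addr0 yk subrr.
(* A late translate of [x] follows [y], which stays at [b k]; sampling it when [x] is near its
   liminf [- a k] gives [b k <= - a k]. *)
have M_le0 : M <= 0.
  have [k kfree _] := maxfree 0 (lexx _).
  have [_ _ <-] := AP t0 k t00 (proj1 (andP kfree)).
  apply/ler_addgt0Pr => e e0.
  have [s ] := yx (e / 2) 0 ltac:(lra); rewrite maxxx => s0 sP.
  have [t st tP] := (aP k).2 (e / 2) (s + t0) ltac:(lra).
  have := sP (t - s) ltac:(lra) k; have := frozen k kfree (t - s - t0) ltac:(lra).
  rewrite /g; have -> : t0 + (t - s - t0) = t - s by lra.
  have -> : s + (t - s) = t by lra.
  by move: tP; rewrite !ler_norml; lra.
exists b => e e0.
have T_ex k : exists T, forall t, T <= t -> `|x t k - b k| <= e.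
  have [T1 T10 T1P] := (bP k).1 e e0; have [T2 T20 T2P] := (aP k).1 e e0.
  exists (Num.max T1 T2) => t; rewrite ge_max => /andP[h1 h2].
  by have := T1P t h1; have := T2P t h2; have := leM k; rewrite ler_norml; lra.
have [T TP] := choice T_ex.
exists (\big[Order.max/0]_k T k) => t tT k; apply: TP.
exact: le_trans (le_bigmax _ _ _) tT.
Qed.

Lemma window_solution_converges (R : realType) (N : nat) (E : rel 'I_N)
    (l r : 'I_N -> 'I_N -> R) (f : 'I_N -> 'I_N -> R -> R)
    (om : 'I_N -> R) (x : R -> 'I_N -> R) :
  strongly_connected E -> window_solution E l r f om x ->
  exists (c : R) (p : 'I_N -> R), forall e, 0 < e -> exists T, forall t, T <= t ->
    forall k, `|x t k - c * t - p k| <= e.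
Proof.
move=> Econn xsol; have [c [D DP]] := linear_drift xsol Econn.
by exists c; exact: bounded_solution_converges (remove_drift xsol c) DP.
Qed.

(** * From angles on the torus to windows on the line *)

(** Distinct multiples of [c] are at least [c] apart, so all those within [c / 4] of [D] coincide,
    and one integer serves every [e]. *)
Lemma near_multiples (R : realType) (c D : R) : 0 < c ->
  (forall e, 0 < e -> exists n : int, `|D - c * n%:~R| < e) ->
  exists n : int, D = c * n%:~R.
Proof.
move=> c0 H; have [n0 n0P] := H (c / 4) ltac:(lra); exists n0.
apply/eqP; rewrite -subr_eq0 -normr_le0; apply/ler_addgt0Pr => e e0; rewrite add0r.
have [n ] := H (Num.min e (c / 4)) ltac:(rewrite lt_min; lra).
rewrite lt_min => /andP[ne nc].
suff -> : n0 = n by exact: ltW.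
have step (i j : int) : i < j -> c * i%:~R + c <= c * j%:~R.
  by rewrite -lezD1 -(ler_int R) intrD => h; rewrite -[X in _ + X]mulr1 -mulrDr ler_pM2l.
move: n0P nc; rewrite !ltr_norml => /andP[h1 h2] /andP[h3 h4].
by have [h|h|//] := ltgtP n0 n; have := step _ _ h => ?; exfalso; lra.
Qed.

Lemma periodic_int (R : realType) (f : R -> R) (c : R) :
  (forall u, f (u + c) = f u) -> forall (m : int) u, f (u - c * m%:~R) = f u.
Proof.
move=> fc; have H (n : nat) u : f (u + c * n%:R) = f u.
  elim: n u => [|n IH] u; first by rewrite mulr0 addr0.
  by rewrite -natr1 mulrDr mulr1 addrA fc.
case=> n u; first by rewrite -(H n (u - _)) subrK.
by rewrite NegzE mulrNz mulrN opprK H.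
Qed.

Section CouplingFunction.
Variables (R : realType) (f : R -> R).
Hypothesis fcoupling : coupling_fun f.

Lemma coupling_fun_incr u v : - pi < u < pi -> - pi < v < pi -> u < v -> f u < f v.
Proof.
have [_ [_ [fd [_ [_ fpos]]]]] := fcoupling.
move=> /andP[u1 u2] /andP[v1 v2] uv.
have der w : u <= w <= v -> is_derive w 1 f (derive1 f w).
  move=> /andP[h1 h2]; rewrite derive1E; apply: derivableP.
  by apply: fd; apply/andP; split; lra.
have [c] := @MVT R f (derive1 f) u v uv
  ltac:(move=> w; rewrite in_itv /= => /andP[? ?]; apply: der; apply/andP; split; lra)
  ltac:(apply: derivable_within_continuous => w; rewrite in_itv /= => h;
        by have [] := der w h).
rewrite in_itv /= => /andP[c1 c2] fE; rewrite -subr_gt0 fE mulr_gt0 ?subr_gt0//.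
by apply: fpos; apply/andP; split; lra.
Qed.

Lemma coupling_fun_shift_incr (m : int) u v :
  2 * pi * m%:~R - pi < u < 2 * pi * m%:~R + pi ->
  2 * pi * m%:~R - pi < v < 2 * pi * m%:~R + pi -> u < v -> f u < f v.
Proof.
have [_ [fper _]] := fcoupling.
move=> /andP[u1 u2] /andP[v1 v2] uv.
rewrite -(periodic_int fper m u) -(periodic_int fper m v).
by apply: coupling_fun_incr; try (apply/andP; split); lra.
Qed.

Lemma coupling_fun_shift_continuous (m : int) u :
  2 * pi * m%:~R - pi < u < 2 * pi * m%:~R + pi -> {for u, continuous f}.
Proof.
have [_ [fper [fd _]]] := fcoupling.
move=> /andP[u1 u2].
have -> : f = f \o (fun w => w - 2 * pi * m%:~R).
  by apply/funext => w /=; rewrite periodic_int.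
apply: continuous_comp; first by apply: cvgB; [exact: cvg_id|exact: cvg_cst].
apply: differentiable_continuous; apply/derivable1_diffP; apply: fd.
by apply/andP; split; lra.
Qed.
End CouplingFunction.

Lemma window_exists (R : realType) (d : R) :
  (forall m : int, d != 2 * pi * m%:~R + pi) ->
  exists m : int, 2 * pi * m%:~R - pi < d < 2 * pi * m%:~R + pi.
Proof.
move=> dN; have pi0 := pi_gt0 R.
pose m := Num.floor ((d + pi) / (2 * pi)); exists m.
have := floor_le ((d + pi) / (2 * pi)); have := floorD1_gt ((d + pi) / (2 * pi)).
rewrite -/m ler_pdivlMr ?ltr_pdivrMr; [|lra..].
rewrite intrD => h1 h2; apply/andP; split; last lra.
rewrite lt_neqAle; apply/andP; split; last lra.
(* The left end is itself an excluded value, the one of index [m - 1]. *)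
apply/eqP => h; have := dN (m - 1); rewrite -h intrB => /eqP; lra.
Qed.

Theorem theorem4p1 (R : realType) (N : nat) (E : rel 'I_N)
  (omega : 'I_N -> R) (f : 'I_N -> 'I_N -> R -> R) (S : set (torus_amb R N)) :
  strongly_connected E ->
  (forall k i, E k i -> coupling_fun (f k i)) ->
  S `<=` range (@torus_proj R N) ->
  connected S ->
  forward_invariant E omega f S ->
  (forall x : 'I_N -> R, S (torus_proj x) ->
     forall k i, E k i -> forall m : int, x k - x i != pi + 2 * pi * m%:~R) ->
  forall th : R -> 'I_N -> R,
    is_solution E omega f th -> S (torus_proj (th 0)) ->
    exists phi : 'I_N -> R,
      converges_to_curve th phi /\
      (forall psi, converges_to_curve th psi -> same_curve phi psi).
Proof.
move=> Econn fcoup _ _ Sinv Santi th thsol S0.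
have pi0 := pi_gt0 R.
have thS t : 0 <= t -> S (torus_proj (th t)) by exact: (Sinv th thsol S0).
have [_ thder] := thsol.
(* The windows are read off at time 1, since the equation is only available at positive times. *)
have [m mP] : {m : 'I_N * 'I_N -> int & forall p, E p.1 p.2 ->
    2 * pi * (m p)%:~R - pi < th 1 p.2 - th 1 p.1 < 2 * pi * (m p)%:~R + pi}.
  apply: (choice (P := fun p n => E p.1 p.2 ->
    2 * pi * n%:~R - pi < th 1 p.2 - th 1 p.1 < 2 * pi * n%:~R + pi)) => -[k i] /=.
  have [Eki|_] := boolP (E k i); last by exists 0.
  have [n|n nP] := @window_exists R (th 1 i - th 1 k); last by exists n.
  (* The index [- n - 1] accounts for the opposite sign of the difference: [pi + 2 * pi * (- n - 1)
     = - (2 * pi * n + pi)]. *)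
  have := Santi _ (thS 1 ler01) k i Eki (- n - 1).
  by apply: contra => /eqP h; apply/eqP; rewrite intrB intrN; lra.
have win t : 1 <= t -> forall k i, E k i -> 2 * pi * (m (k, i))%:~R - pi <
    th t i - th t k < 2 * pi * (m (k, i))%:~R + pi.
  move=> t1 k i Eki; have /= /andP[w1 w2] := mP (k, i) Eki.
  have dc : {within `[1, t], continuous (fun s => th s i - th s k)}.
    apply: derivable_within_continuous => s; rewrite in_itv /= => /andP[s1 _].
    by apply: derivableB; [have [] := thder s ltac:(lra) i | have [] := thder s ltac:(lra) k].
  (* By the intermediate value theorem, leaving the window would mean passing through an antipodal
     configuration, which [S] excludes. *)
  have noroot v : (exists n : int, v = 2 * pi * n%:~R + pi) ->
      ~ (Num.min (th 1 i - th 1 k) (th t i - th t k) <= v <=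
         Num.max (th 1 i - th 1 k) (th t i - th t k)).
    move=> [n ->] /(IVT t1 dc)[s]; rewrite in_itv /= => /andP[s1 _] sE.
    have /eqP := Santi _ (thS s ltac:(lra)) k i Eki (- n - 1); apply.
    by rewrite intrB intrN; lra.
  apply/andP; split; rewrite ltNge; apply/negP => h.
  - apply: (noroot (2 * pi * (m (k, i))%:~R - pi)).
      by exists (m (k, i) - 1); rewrite intrB; lra.
    by rewrite ge_min le_max h (ltW w1) orbT.
  - apply: (noroot (2 * pi * (m (k, i))%:~R + pi)); first by exists (m (k, i)).
    by rewrite ge_min le_max h (ltW w2) orbT.
pose x t := th (t + 1).
have xsol : window_solution E (fun k i => 2 * pi * (m (k, i))%:~R - pi)
    (fun k i => 2 * pi * (m (k, i))%:~R + pi) f omega x.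
  split.
  - by move=> k i Eki u v; apply: coupling_fun_shift_incr; exact: fcoup.
  - by move=> k i Eki u; apply: coupling_fun_shift_continuous; exact: fcoup.
  - by move=> t t0 k i Eki; apply: win => //; lra.
  - move=> t t0 k; have [d dE] := thder (t + 1) ltac:(lra) k.
    rewrite -dE -[X in is_derive _ _ _ X]mulr1.
    apply: (@is_derive1_comp _ (fun s => th s k) (shift 1)).
      by rewrite derive1E; exact: derivableP.
    exact: is_derive_shift.
have [c [phi phiP]] := window_solution_converges Econn xsol.
have thphi e : 0 < e -> exists T, forall t, T <= t -> forall k,
    `|th t k - (phi k + c * (t - 1))| <= e.
  move=> /phiP[T TP]; exists (T + 1) => t tT k.
  have := TP (t - 1) ltac:(lra) k; rewrite /x subrK.
  by rewrite !ler_norml; lra.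
exists phi; split.
  move=> e e0; have [T TP] := thphi (e / 2) ltac:(lra).
  exists T => t tT; exists (c * (t - 1)) => k; exists 0.
  by rewrite mulr0z mulr0 subr0; have := TP t tT k; lra.
move=> psi psiP.
have [k0 _|N0] := pickP 'I_N; last by exists 0 => k; have := N0 k.
(* Node [k0] fixes the shift. At a common late time both curves are close to [th] modulo [2 * pi];
   subtracting the estimates at [k] and [k0] cancels the unknown shifts and leaves a difference near
   a multiple of [2 * pi]. *)
exists (psi k0 - phi k0) => k.
have [||n nP] := @near_multiples R (2 * pi) (psi k - phi k - (psi k0 - phi k0)).
- lra.
- move=> e e0; have [T1 T1P] := thphi (e / 8) ltac:(lra).
  have [T2 T2P] := psiP (e / 8) ltac:(lra).
  pose t := Num.max T1 T2.
  have [s sP] := T2P t ltac:(by rewrite le_max lexx orbT).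
  have := T1P t ltac:(by rewrite le_max lexx); move: (c * (t - 1)) => ct ctP.
  have [n nP] := sP k; have [n0 n0P] := sP k0.
  exists (n0 - n); have := ctP k; have := ctP k0.
  by move: nP n0P; rewrite intrB mulrBr !ler_norml !ltr_norml; lra.
by exists n; lra.
Qed.
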